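(* Let $G$ be a finite group, let $\mathcal{P}$ be a $G$-poset with an initial object $x_0$, and let $$\mathcal{K}\to\mathcal{P}\rtimes G\xrightarrow{\rho}\mathcal{C}$$ be a category extension. Give $\mathcal{C}$ the atomic topology and write $\mathbf{C}$ for the resulting site. Then the sheafification of a presheaf of sets $\mathfrak{G}\in\mathrm{PSh}(\mathcal{C})$ is the fixed-point sheaf $\mathfrak{F}_{\mathfrak{G}(x_0)}\in\mathrm{Sh}(\mathbf{C})$, in the sense that $\mathfrak{F}_{\mathfrak{G}(x_0)}(x)=\mathfrak{G}(x_0)^{\mathcal{K}(x)}$ for every object $x$. Consequently, the sheaves on $\mathbf{C}$ are (up to isomorphism) those of the form $\mathfrak{F}_M$ with $M$ running over all $G$-sets. In particular, the sheaves on $\mathbf{P}G$, i.e. on $\mathcal{P}\rtimes G$ with the atomic topology, are (up to isomorphism) all the constant sheaves $\kappa_M$, $M$ a $G$-set.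
   Context: Transporter category. A $G$-poset $\mathcal{P}$ is a poset with a right action of $G$ by order-preserving maps $x\mapsto x^g$; it is regarded as a category with one morphism $\iota^y_x:x\to y$ whenever $x\le y$. The transporter category $\mathcal{P}\rtimes G$ has the same objects as $\mathcal{P}$; its morphisms $x\to y$ are the formal products $\iota^y_{x^g}g$ with $g\in G$, $x^g\le y$; composition is $(\iota^y_{x^g}g)(\iota^x_{w^h}h)=\iota^y_{w^{hg}}(hg)$. The group $G$ is regarded as a category with one object $\bullet$ and composition the group product, so presheaves of sets on $G$ are right $G$-sets (''$G$-set'' means right $G$-set). The functor $\pi:\mathcal{P}\rtimes G\to G$ sends every object to $\bullet$ and $\iota^y_{x^g}g$ to $g^{-1}$. Category extension. A category extension $\mathcal{K}\xrightarrow{i}\mathcal{P}\rtimes G\xrightarrow{\rho}\mathcal{C}$ consists of two functors such that: the three categories have the same objects, $i$ and $\rho$ are identities on objects, $i$ is injective on morphisms and $\rho$ is surjective on morphisms; and whenever $u,v$ are morphisms of $\mathcal{P}\rtimes G$ with $\rho(u)=\rho(v)$ there is a unique morphism $w$ of $\mathcal{K}$ with $i(w)u=v$. Here $\mathcal{K}=\coprod_x\mathcal{K}(x)$ where $\mathcal{K}(x)$ is the one-object category (a group) whose morphisms are those mapped to $1_x$ by $\rho i$; it is identified with a subgroup of $\mathrm{Aut}_{\mathcal{P}\rtimes G}(x)$, hence (via group elements $g$ in $\iota^x_{x^g}g$) with a subgroup of $G$. Topology. The atomic topology declares the covering sieves on each object to be all non-empty sieves (it is defined since $\mathcal{C}$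 and $\mathcal{P}\rtimes G$ satisfy the Ore condition: every pair of morphisms with common codomain can be completed to a commutative square). Sheaves in the statement. The initial object $x_0$ is fixed by $G$, so $\mathrm{Aut}_{\mathcal{P}\rtimes G}(x_0)=\{\iota^{x_0}_{x_0}g\mid g\in G\}$ and, for a presheaf $\mathfrak{G}$ on $\mathcal{C}$, $\mathfrak{G}(x_0)$ is a right $G$-set by $m\cdot g=\mathfrak{G}(\rho(\iota^{x_0}_{x_0}g^{-1}))(m)$. For a $G$-set $M$, the constant presheaf is $\kappa_M=\mathrm{Res}_\pi(M)$ (precomposition with $\pi$): $\kappa_M(x)=M$ for all $x$, and $\iota^y_{x^g}g$ acts as $m\mapsto m g^{-1}$ (so it is constant on objects, not on morphisms). The fixed-point presheaf $\mathfrak{F}_M$ on $\mathcal{C}$ is $\mathfrak{F}_M(x)=M^{\mathcal{K}(x)}$, with $\rho(\iota^y_{x^g}g):x\to y$ inducing $M^{\mathcal{K}(y)}\to M^{\mathcal{K}(x)}$, $m\mapsto m g^{-1}$. *)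

(* Defs.v *)
From mathcomp Require Import all_boot all_order all_fingroup.
From mathcomp Require Import boolp.

Set Implicit Arguments.
Unset Strict Implicit.
Unset Printing Implicit Defensive.
Import Order.TTheory GroupScope.

(* A category whose type of objects is the parameter [O]; two categories "with
   the same objects" are then two inhabitants of [category O]. *)
Record category (O : Type) := Category {
  hom :> O -> O -> Type;
  idm : forall x, hom x x;
  comp : forall x y z, hom y z -> hom x y -> hom x z;
  comp1m : forall x y (f : hom x y), comp (idm y) f = f;
  compm1 : forall x y (f : hom x y), comp f (idm x) = f;
  compA : forall w x y z (f : hom y z) (g : hom x y) (h : hom w x),
    comp f (comp g h) = comp (comp f g) h }.

Arguments idm {O} c x.
Arguments comp {O c x y z} f g.

Declare Scope cat_scope.
Local Open Scope cat_scope.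
Notation "f \oc g" := (comp f g) (at level 50, left associativity) : cat_scope.

(* A functor with prescribed object map [o]; a functor which is the identity on
   objects is a [functor id C D]. *)
Record functor (O1 O2 : Type) (o : O1 -> O2)
    (C : category O1) (D : category O2) := Functor {
  fmap :> forall x y, C x y -> D (o x) (o y);
  fmap1 : forall x, fmap (idm C x) = idm D (o x);
  fmapM : forall x y z (f : C y z) (g : C x y),
    fmap (f \oc g) = fmap f \oc fmap g }.

Section Presheaves.
Variables (O : Type) (C : category O).

Record presheaf := Presheaf {
  psh :> O -> Type;
  pmap : forall x y, C x y -> psh y -> psh x;
  pmap1 : forall x (m : psh x), pmap (idm C x) m = m;
  pmapM : forall x y z (f : C y z) (g : C x y) (m : psh z),
    pmap (f \oc g) m = pmap g (pmap f m) }.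

Record nattrans (F H : presheaf) := NatTrans {
  ntmap :> forall x, F x -> H x;
  ntnat : forall x y (f : C x y) (m : F y),
    ntmap (pmap f m) = pmap f (ntmap m) }.

Definition presheaf_iso (F H : presheaf) : Prop :=
  exists (a : nattrans F H) (b : nattrans H F),
    (forall x (m : F x), b x (a x m) = m) /\
    (forall x (m : H x), a x (b x m) = m).

Record sieve (x : O) := Sieve {
  in_sieve :> forall y, C y x -> Prop;
  sieve_closed : forall y z (f : C y x) (g : C z y),
    in_sieve f -> in_sieve (f \oc g) }.

Definition max_sieve x : sieve x :=
  @Sieve x (fun _ _ => True) (fun _ _ _ _ _ => I).

Lemma pull_sieve_closed x y (f : C y x) (S : sieve x) z t
    (g : C z y) (h : C t z) :
  S z (f \oc g) -> S t (f \oc (g \oc h)).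
Proof. by rewrite compA; apply: sieve_closed. Qed.

Definition pull_sieve x y (f : C y x) (S : sieve x) : sieve y :=
  @Sieve y (fun z g => S z (f \oc g)) (@pull_sieve_closed x y f S).

Record topology := Topology {
  covers :> forall x, sieve x -> Prop;
  covers_max : forall x, covers (max_sieve x);
  covers_pull : forall x y (f : C y x) (S : sieve x),
    covers S -> covers (pull_sieve f S);
  covers_trans : forall x (S R : sieve x), covers S ->
    (forall y (f : C y x), S y f -> covers (pull_sieve f R)) -> covers R }.

Definition is_matching (F : presheaf) x (S : sieve x)
    (s : forall y (f : C y x), S y f -> F y) : Prop :=
  forall y z (f : C y x) (g : C z y) (Sf : S y f) (Sfg : S z (f \oc g)),
    pmap g (s y f Sf) = s z (f \oc g) Sfg.

Definition is_sheaf (J : topology) (F : presheaf) : Prop :=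
  forall x (S : sieve x), J x S ->
  forall s : (forall y (f : C y x), S y f -> F y), is_matching s ->
  exists! t : F x, forall y (f : C y x) (Sf : S y f), pmap f t = s y f Sf.

Definition is_sheafification (J : topology) (F A : presheaf) : Prop :=
  is_sheaf J A /\
  exists eta : nattrans F A,
    forall H : presheaf, is_sheaf J H -> forall theta : nattrans F H,
    exists! theta' : nattrans A H,
      forall x (m : F x), theta' x (eta x m) = theta x m.

Definition ore : Prop :=
  forall x y z (f : C x z) (g : C y z),
  exists w (f' : C w x) (g' : C w y), f \oc f' = g \oc g'.

Definition atomic_covers x (S : sieve x) : Prop := exists y (f : C y x), S y f.

Lemma atomic_covers_max x : atomic_covers (max_sieve x).
Proof. by exists x, (idm C x). Qed.

Lemma atomic_covers_pull (oreC : ore) x y (f : C y x) (S : sieve x) :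
  atomic_covers S -> atomic_covers (pull_sieve f S).
Proof.
move=> [z [g Sg]]; have [w [f' [g' e]]] := oreC _ _ _ f g.
by exists w, f'; rewrite /= e; apply: sieve_closed.
Qed.

Lemma atomic_covers_trans x (S R : sieve x) : atomic_covers S ->
  (forall y (f : C y x), S y f -> atomic_covers (pull_sieve f R)) ->
  atomic_covers R.
Proof.
move=> [y [f Sf]] /(_ _ _ Sf)[z [g Rfg]].
by exists z, (f \oc g).
Qed.

Definition atomic (oreC : ore) : topology :=
  Topology atomic_covers_max (atomic_covers_pull oreC) atomic_covers_trans.

End Presheaves.

Arguments pmap {O C} p {x y} _ _.
Arguments ore {O} C.
Arguments atomic {O C} oreC.

Section Restriction.
Variables (O1 O2 : Type) (o : O1 -> O2) (C : category O1) (D : category O2).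
Variables (p : functor o C D) (F : presheaf D).

Definition res_map x y (f : C x y) : F (o y) -> F (o x) := pmap F (p x y f).

Lemma res_map1 x (m : F (o x)) : res_map (idm C x) m = m.
Proof. by rewrite /res_map fmap1 pmap1. Qed.

Lemma res_mapM x y z (f : C y z) (g : C x y) (m : F (o z)) :
  res_map (f \oc g) m = res_map g (res_map f m).
Proof. by rewrite /res_map fmapM pmapM. Qed.

Definition Res : presheaf C :=
  @Presheaf O1 C (fun x => F (o x)) res_map res_map1 res_mapM.

End Restriction.

Section Groups.
Variable gT : finGroupType.

(* The library states [act1] and [actM] only for actions on finite types. *)
Lemma taction1 (T : Type) (to : {action gT &-> T}) (x : T) : to x 1 = x.
Proof.
case: to => to [to_inj toM] /=; apply: (to_inj 1).
by rewrite -toM ?inE // mulg1.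
Qed.

Lemma tactionM (T : Type) (to : {action gT &-> T}) (x : T) (g h : gT) :
  to x (g * h) = to (to x g) h.
Proof. by case: to => to [to_inj toM] /=; apply: toM; rewrite inE. Qed.

Record gSet := GSet {
  gset_sort :> Type;
  gset_act : {action gT &-> gset_sort} }.

Record gPoset := GPoset {
  gposet_disp : Order.disp_t;
  gposet_sort :> porderType gposet_disp;
  gposet_act : {action gT &-> gposet_sort};
  gposet_homo : forall g, {homo gposet_act^~ g : x y / (x <= y)%O} }.

Definition group_cat : category unit :=
  @Category unit (fun _ _ => gT) (fun _ => 1) (fun _ _ _ u v => u * v)
    (fun _ _ u => mul1g u) (fun _ _ u => mulg1 u)
    (fun _ _ _ _ u v w => mulgA u v w).

Definition gset_presheaf (M : gSet) : presheaf group_cat :=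
  @Presheaf unit group_cat (fun _ => M) (fun _ _ g m => gset_act M m g)
    (fun _ m => taction1 (gset_act M) m)
    (fun _ _ _ g h m => tactionM (gset_act M) m g h).

Section Transporter.
Variable P : gPoset.
Local Notation act := (gposet_act P).

(* The formal product of the arrow x^g -> y with g is encoded by g alone. *)
Definition tp_hom (x y : P) : Type := {g : gT | (act x g <= y)%O}.

Lemma tp_id_subproof (x : P) : (act x 1 <= x)%O.
Proof. by rewrite taction1. Qed.

Lemma tp_comp_subproof (w x y : P) (u : tp_hom x y) (v : tp_hom w x) :
  (act w (val v * val u) <= y)%O.
Proof.
rewrite tactionM; apply: le_trans (valP u).
by apply: gposet_homo (valP v).
Qed.

Definition tp_id (x : P) : tp_hom x x := exist _ 1 (tp_id_subproof x).

Definition tp_comp (w x y : P) (u : tp_hom x y) (v : tp_hom w x) : tp_hom w y :=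
  exist _ (val v * val u) (tp_comp_subproof u v).

Lemma tp_comp1m (x y : P) (u : tp_hom x y) : tp_comp (tp_id y) u = u.
Proof. by apply: val_inj; rewrite /= mulg1. Qed.

Lemma tp_compm1 (x y : P) (u : tp_hom x y) : tp_comp u (tp_id x) = u.
Proof. by apply: val_inj; rewrite /= mul1g. Qed.

Lemma tp_compA (w x y z : P) (u : tp_hom y z) (v : tp_hom x y)
    (t : tp_hom w x) :
  tp_comp u (tp_comp v t) = tp_comp (tp_comp u v) t.
Proof. by apply: val_inj; rewrite /= mulgA. Qed.

Definition transporter : category P :=
  Category tp_comp1m tp_compm1 tp_compA.

Definition tp_pi_map (x y : P) (u : transporter x y) : group_cat tt tt :=
  (val u)^-1.

Lemma tp_pi_map1 (x : P) : tp_pi_map (idm transporter x) = idm group_cat tt.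
Proof. exact: invg1. Qed.

Lemma tp_pi_mapM (x y z : P) (u : transporter y z) (v : transporter x y) :
  tp_pi_map (u \oc v) = tp_pi_map u \oc tp_pi_map v.
Proof. exact: invMg. Qed.

Definition tp_pi : functor (fun _ : P => tt) transporter group_cat :=
  @Functor _ _ (fun _ : P => tt) transporter group_cat
    tp_pi_map tp_pi_map1 tp_pi_mapM.

Definition kappa (M : gSet) : presheaf transporter :=
  Res tp_pi (gset_presheaf M).

Section Initial.
Variables (x0 : P) (x0_initial : forall x : P, (x0 <= x)%O).

Lemma initial_fixed (g : gT) : act x0 g = x0.
Proof.
apply: le_anti; rewrite x0_initial andbT.
rewrite -[leRHS](taction1 act) -(mulVg g) tactionM.
by apply: gposet_homo; apply: x0_initial.
Qed.

Lemma initial_le (x : P) (g : gT) : (act x0 g <= x)%O.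
Proof. by rewrite initial_fixed; apply: x0_initial. Qed.

Definition tp_from_initial (x : P) (g : gT) : transporter x0 x :=
  exist _ g (initial_le x g).

Lemma transporter_ore : ore transporter.
Proof.
move=> x y z f g.
exists x0, (tp_from_initial x 1), (tp_from_initial y (val f * (val g)^-1)).
by apply: val_inj; rewrite /= mul1g mulgKV.
Qed.

End Initial.

Section Extension.
Variables K C : category P.

(* [ext_diag] and [ext_ker] say that K is the disjoint union of the groups
   K(x), whose elements are sent to the identity of x in C. *)
Record extension := Extension {
  ext_i : functor id K transporter;
  ext_rho : functor id transporter C;
  ext_inj : forall x y : P, injective (@fmap _ _ _ _ _ ext_i x y);
  ext_surj : forall (x y : P) (f : C x y),
    exists u : transporter x y, ext_rho x y u = f;
  ext_diag : forall x y : P, K x y -> x = y;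
  ext_ker : forall (x : P) (w : K x x), ext_rho x x (ext_i x x w) = idm C x;
  ext_tors : forall (x y : P) (u v : transporter x y),
    ext_rho x y u = ext_rho x y v ->
    exists! w : K y y, ext_i y y w \oc u = v }.

Variable E : extension.
Local Notation ei := (ext_i E).
Local Notation rho := (ext_rho E).

Definition ext_subgroup (x : P) : {set gT} :=
  [set g | `[< exists w : K x x, val (ei x x w) = g >]].

Lemma ext_subgroupP (x : P) (g : gT) :
  reflect (exists w : K x x, val (ei x x w) = g) (g \in ext_subgroup x).
Proof. by rewrite inE; apply: asboolP. Qed.

Lemma ext_subgroup_group_set (x : P) : group_set (ext_subgroup x).
Proof.
apply/group_setP; split=> [|_ _ /ext_subgroupP[v <-] /ext_subgroupP[w <-]].
  by apply/ext_subgroupP; exists (idm K x); rewrite fmap1.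
by apply/ext_subgroupP; exists (w \oc v); rewrite fmapM.
Qed.

Canonical ext_subgroup_group (x : P) := Group (ext_subgroup_group_set x).

Lemma extension_ore (x0 : P) (x0_initial : forall x : P, (x0 <= x)%O) : ore C.
Proof.
move=> x y z f g.
have [[u <-] [v <-]] := (ext_surj E f, ext_surj E g).
have [w [u' [v' e]]] := transporter_ore x0_initial u v.
by exists w, (rho _ _ u'), (rho _ _ v'); rewrite -!fmapM e.
Qed.

Section FixedPoints.
Variable M : gSet.

Definition fixed_points (x : P) : Type :=
  {m : M | forall k, k \in ext_subgroup x -> gset_act M m k = m}.

Lemma fixed_points_inj (x : P) (m n : fixed_points x) :
  sval m = sval n -> m = n.
Proof.
case: m n => [m mP] [n nP] /= emn; case: n / emn nP => nP.
by rewrite (Prop_irrelevance mP nP).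
Qed.

(* Two lifts of an arrow of C differ by an element of K(y), so the action of
   the chosen lift in [fp_map] does not depend on the choice: [fp_map_rho]. *)
Lemma lift_act (x y : P) (u v : transporter x y) (m : fixed_points y) :
  rho x y u = rho x y v ->
  gset_act M (sval m) (val u)^-1 = gset_act M (sval m) (val v)^-1.
Proof.
move=> /(ext_tors (e := E))[w [<- _]] /=.
rewrite invMg tactionM; congr (gset_act M _ _).
by rewrite (svalP m) // groupV; apply/ext_subgroupP; exists w.
Qed.

Lemma fp_stable (x y : P) (u : transporter x y) (m : fixed_points y) k :
  k \in ext_subgroup x ->
  gset_act M (gset_act M (sval m) (val u)^-1) k
    = gset_act M (sval m) (val u)^-1.
Proof.
rewrite -groupV => /ext_subgroupP[w ew].
rewrite -tactionM -[k]invgK -ew -invMg.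
apply: (@lift_act _ _ (u \oc ei x x w) u).
by rewrite fmapM ext_ker compm1.
Qed.

Definition fp_lift (x y : P) (f : C x y) : transporter x y :=
  sval (cid (ext_surj E f)).

Lemma fp_liftK (x y : P) (f : C x y) : rho x y (fp_lift f) = f.
Proof. exact: (svalP (cid (ext_surj E f))). Qed.

Definition fp_map (x y : P) (f : C x y) (m : fixed_points y) : fixed_points x :=
  exist _ (gset_act M (sval m) (val (fp_lift f))^-1) (fp_stable (fp_lift f) m).

Lemma fp_map_rho (x y : P) (u : transporter x y) (m : fixed_points y) :
  sval (fp_map (rho x y u) m) = gset_act M (sval m) (val u)^-1.
Proof. by apply: lift_act; rewrite fp_liftK. Qed.

Lemma fp_map1 (x : P) (m : fixed_points x) : fp_map (idm C x) m = m.
Proof.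
apply: fixed_points_inj; rewrite -(fmap1 rho).
by rewrite fp_map_rho /= invg1 taction1.
Qed.

Lemma fp_mapM (x y z : P) (f : C y z) (g : C x y) (m : fixed_points z) :
  fp_map (f \oc g) m = fp_map g (fp_map f m).
Proof.
apply: fixed_points_inj.
have [[u <-] [v <-]] := (ext_surj E f, ext_surj E g).
by rewrite -fmapM !fp_map_rho /= invMg tactionM.
Qed.

Definition fixed_point_presheaf : presheaf C := Presheaf fp_map1 fp_mapM.

End FixedPoints.

Section InitialValue.
Variables (x0 : P) (x0_initial : forall x : P, (x0 <= x)%O).
Variable F : presheaf C.

Definition initial_act (m : F x0) (g : gT) : F x0 :=
  pmap F (rho x0 x0 (tp_from_initial x0_initial x0 g^-1)) m.

Lemma initial_act1 m : initial_act m 1 = m.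
Proof.
rewrite /initial_act (_ : tp_from_initial _ _ _ = idm transporter x0).
  by rewrite fmap1 pmap1.
by apply: val_inj; rewrite /= invg1.
Qed.

Lemma initial_actM m : act_morph initial_act m.
Proof.
move=> g h; rewrite /initial_act -pmapM -fmapM.
congr (pmap F (rho x0 x0 _) m).
by apply: val_inj; rewrite /= invMg.
Qed.

Definition initial_gset : gSet :=
  GSet (TotalAction initial_act1 initial_actM).

End InitialValue.
End Extension.
End Transporter.
End Groups.

(* Main.v *)
Require Import Defs.
From mathcomp Require Import all_boot all_order all_fingroup.
From mathcomp Require Import boolp.
Import Defs.

(** Every non-empty sieve on [x] contains the image [iota x] in [C] of the arrow
    [x0 -> x], since any two arrows [x0 -> x] differ by an automorphism of [x0].
    Two arrows into [x0] that agree after [iota x] differ by an element of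
    [K(x)], so for a sheaf [H] the restriction along [iota x] identifies [H x]
    with the [K(x)]-fixed points of [H x0]. Hence [F x -> F x0] is the unit of
    the sheafification. The statement on the transporter category is the case of
    the extension whose groups [K(x)] are all trivial. *)

Set Implicit Arguments.
Unset Strict Implicit.
Unset Printing Implicit Defensive.
Import Order.TTheory GroupScope.
Local Open Scope cat_scope.

(** * Isomorphisms of presheaves, and descent along a single arrow *)

Section Presheaves.
Variables (O : Type) (C : category O).

Lemma presheaf_iso_sym (F H : presheaf C) :
  presheaf_iso F H -> presheaf_iso H F.
Proof. by move=> [a [b [ba ab]]]; exists b, a. Qed.

Definition nattrans_comp (F H L : presheaf C) (b : nattrans H L)
    (a : nattrans F H) : nattrans F L.
Proof.
by exists (fun x m => b x (a x m)) => x y f m; rewrite !ntnat.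
Defined.

Lemma presheaf_iso_trans (H F L : presheaf C) :
  presheaf_iso F H -> presheaf_iso H L -> presheaf_iso F L.
Proof.
move=> [a [b [ba ab]]] [c [d [dc cd]]].
exists (nattrans_comp c a), (nattrans_comp b d).
by split=> x m /=; rewrite ?dc ?ba ?ab ?cd.
Qed.

Lemma is_sheaf_iso (J : topology C) (F H : presheaf C) :
  presheaf_iso F H -> is_sheaf J H -> is_sheaf J F.
Proof.
move=> [a [b [ba ab]]] shH x S JS s s_match.
have [|t [tP t_uniq]] := shH x S JS (fun y f Sf => a y (s y f Sf)).
  by move=> y z f g Sf Sfg; rewrite -ntnat s_match.
exists (b x t); split=> [y f Sf|t' t'P]; first by rewrite -ntnat tP ba.
by rewrite (t_uniq (a x t')) ?ba // => y f Sf; rewrite -ntnat t'P.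
Qed.

(** The arrows factoring through [f] form a non-empty sieve. The hypothesis on [p] makes
    [pmap F h p] depend only on [f \oc h], so these elements form a matching family on that
    sieve. *)
Lemma sheaf_descent (oreC : ore C) (F : presheaf C) :
  is_sheaf (atomic oreC) F -> forall x y (f : C y x) (p : F y),
  (forall z (h h' : C z y), f \oc h = f \oc h' -> pmap F h p = pmap F h' p) ->
  exists! t : F x, pmap F f t = p.
Proof.
move=> shF x y f p compat.
have S_closed z w (g : C z x) (h : C w z) :
    (exists k : C z y, g = f \oc k) -> exists k : C w y, g \oc h = f \oc k.
  by move=> [k ->]; exists (k \oc h); rewrite compA.
pose S := Sieve S_closed.
(* A factor of [g] through [f] is chosen here; [sE] shows that the choice is immaterial. *)
pose s z (g : C z x) (Sg : S z g) := pmap F (sval (cid Sg)) p.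
have sE z (g : C z x) (Sg : S z g) (h : C z y) :
    g = f \oc h -> s z g Sg = pmap F h p.
  by move=> gE; apply: compat; rewrite -(svalP (cid Sg)).
have Sf : S y f by exists (idm C y); rewrite compm1.
have [||t [tP t_uniq]] := shF x S _ s; first by exists y, f.
  move=> z w g h Sg Sgh; rewrite [RHS](sE _ _ _ (sval (cid Sg) \oc h)).
    by rewrite pmapM.
  by rewrite compA -(svalP (cid Sg)).
exists t; split=> [|t' t'P].
  by rewrite (tP _ _ Sf) (sE _ _ _ (idm C y)) ?pmap1 ?compm1.
apply: t_uniq => z g Sg; have [h gE] := Sg.
by rewrite (sE _ _ _ h gE) gE pmapM t'P.
Qed.

End Presheaves.

(** * Fixed-point presheaves of an extension and the arrows [iota x] *)

Section FixedPointSheaves.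
Variables (gT : finGroupType) (P : gPoset gT) (x0 : P).
Variable x0_initial : forall x : P, (x0 <= x)%O.
Variables (K C : category P) (E : extension K C).

Local Notation rho := (ext_rho E).
Local Notation from_x0 := (tp_from_initial x0_initial).
Local Notation iota x := (rho x0 x (from_x0 x 1)).
Local Notation sheaf := (is_sheaf (atomic (extension_ore E x0_initial))).

Lemma tp_comp_from_initial (x y : P) (u : transporter P x y) g :
  u \oc from_x0 x g = from_x0 y (g * val u).
Proof. exact: val_inj. Qed.

Lemma iota_comp (x : P) g :
  iota x \oc rho x0 x0 (from_x0 x0 g) = rho x0 x (from_x0 x g).
Proof. by rewrite -fmapM tp_comp_from_initial /= mulg1. Qed.

(** This square turns restriction along [rho x y u] into the action of the group element [val u] on
    values at [x0]. *)
Lemma rho_comp_iota (x y : P) (u : transporter P x y) :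
  rho x y u \oc iota x = iota y \oc rho x0 x0 (from_x0 x0 (val u)).
Proof. by rewrite iota_comp -fmapM tp_comp_from_initial mul1g. Qed.

(** The element [k] can be moved past [iota x], where it becomes an endomorphism of [x] coming from
    [K], which [rho] sends to the identity. *)
Lemma iota_absorb (x : P) k : k \in ext_subgroup E x ->
  iota x \oc rho x0 x0 (from_x0 x0 k) = iota x.
Proof. by case/ext_subgroupP=> w <-; rewrite -rho_comp_iota ext_ker comp1m. Qed.

Lemma fixed_point_pmapE (M : gSet gT) (x y : P) (u : transporter P x y)
    (m : fixed_point_presheaf E M y) :
  sval (pmap (fixed_point_presheaf E M) (rho x y u) m)
    = gset_act M (sval m) (val u)^-1.
Proof. exact: fp_map_rho. Qed.

Lemma fixed_point_pmap_iota (M : gSet gT) (x : P)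
    (m : fixed_point_presheaf E M x) :
  sval (pmap (fixed_point_presheaf E M) (iota x) m) = sval m.
Proof. by rewrite fixed_point_pmapE invg1 taction1. Qed.

Lemma atomic_covers_iota (x : P) (S : sieve C x) :
  atomic_covers S -> S x0 (iota x).
Proof.
move=> [y [f Sf]]; have [u uE] := ext_surj E f.
(* The label [(val u)^-1] cancels that of [u], so the composite is the arrow from [x0] with label
   1. *)
have := sieve_closed (rho x0 y (from_x0 y (val u)^-1)) Sf.
by rewrite -uE -fmapM tp_comp_from_initial mulVg.
Qed.

(** The member of a matching family at [iota x] determines all the others and is fixed by K(x), so
    it is itself the glued section. *)
Lemma fixed_point_sheaf (M : gSet gT) : sheaf (fixed_point_presheaf E M).
Proof.
set FM := fixed_point_presheaf E M.
move=> x S /atomic_covers_iota Siota s s_match.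
have s_iota y (u : transporter P y x) (Su : S y (rho y x u)) :
    sval (s y _ Su) = gset_act M (sval (s x0 _ Siota)) (val u)^-1.
  (* The arrow [rho y x u \oc iota y] also factors as [iota x] after an automorphism of [x0];
     matching is applied to both factorizations. *)
  have Sui := sieve_closed (iota y) Su.
  rewrite -(fixed_point_pmap_iota (s y _ Su)) (s_match _ _ _ _ _ Sui).
  move: Sui; rewrite rho_comp_iota => Sui.
  by rewrite -(s_match _ _ _ _ Siota) fixed_point_pmapE.
have s_fixed k : k \in ext_subgroup E x ->
    gset_act M (sval (s x0 _ Siota)) k = sval (s x0 _ Siota).
  rewrite -groupV => kK.
  (* For [k] in K(x), the arrow labelled [k^-1] is another lift of [iota x]; comparing the two lifts
     gives invariance under [k]. *)
  have := @s_iota x0 (from_x0 x k^-1); rewrite -iota_comp iota_absorb // => sE.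
  by rewrite [RHS]sE /= invgK.
exists (exist _ _ s_fixed); split=> [y f Sf|t tP].
  apply: fixed_points_inj; have [u uE] := ext_surj E f.
  by case: f / uE Sf => Sf; rewrite fixed_point_pmapE [RHS]s_iota.
apply: fixed_points_inj => /=.
by rewrite -(tP _ _ Siota) fixed_point_pmap_iota.
Qed.

(** * The unit map and descent to fixed points of the value at [x0] *)

Section Unit.
Variable F : presheaf C.
Local Notation FG := (initial_gset E x0_initial F).
Local Notation FF := (fixed_point_presheaf E FG).

Lemma pmap_iota_fixed (x : P) (m : F x) k : k \in ext_subgroup E x ->
  gset_act FG (pmap F (iota x) m) k = pmap F (iota x) m.
Proof.
by move=> kK; rewrite /= /initial_act -pmapM iota_absorb ?groupV.
Qed.

Definition fp_unit_map (x : P) (m : F x) : FF x :=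
  exist _ (pmap F (iota x) m) (pmap_iota_fixed m).

Lemma fp_unit_nat (x y : P) (f : C x y) (m : F y) :
  fp_unit_map (pmap F f m) = pmap FF f (fp_unit_map m).
Proof.
apply: fixed_points_inj; have [u <-] := ext_surj E f.
by rewrite fixed_point_pmapE /= /initial_act -!pmapM rho_comp_iota invgK.
Qed.

Definition fp_unit : nattrans F FF := NatTrans fp_unit_nat.

Lemma fp_unit_initial (m : F x0) : sval (fp_unit x0 m) = m.
Proof.
rewrite /= (_ : from_x0 x0 1 = idm (transporter P) x0) ?fmap1 ?pmap1 //.
exact: val_inj.
Qed.

(** Restricted to [x0], every element comes from the unit. Hence a map to a sheaf is determined by
    its composite with the unit. *)
Lemma pmap_iota_fp_unit (x : P) (n : FF x) :
  pmap FF (iota x) n = fp_unit x0 (sval n).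
Proof.
by apply: fixed_points_inj; rewrite fixed_point_pmap_iota fp_unit_initial.
Qed.

Lemma sheaf_fixed_descent : sheaf F -> forall (x : P) (p : F x0),
  (forall k, k \in ext_subgroup E x -> gset_act FG p k = p) ->
  exists! t : F x, pmap F (iota x) t = p.
Proof.
move=> shF x p pP; apply: (sheaf_descent shF) => z h h'.
have [[u <-] [v <-]] := (ext_surj E h, ext_surj E h').
(* The torsor property yields [w] in K(x) with [val v] equal to [val u] times the label of [w]. That
   label, read as an automorphism of [x0], carries [u] to [v]. *)
rewrite -!fmapM => /(ext_tors (e := E))[w [/(congr1 val) + _]].
rewrite /= !mulg1 => vE.
have -> : v = from_x0 x0 (val (ext_i E x x w)) \oc u by apply: val_inj.
(* The action on [F x0] is defined through inverses, so invariance is used for the inverse label. *)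
rewrite fmapM pmapM; congr pmap; rewrite -[LHS](pP (val (ext_i E x x w))^-1).
  by rewrite /= /initial_act invgK.
by rewrite groupV; apply/ext_subgroupP; exists w.
Qed.

End Unit.

(** The value at [n] must restrict along [iota x] to [theta x0 (sval n)]. This element is fixed by
    K(x) because [theta] commutes with the action, so descent in [H] provides exactly one
    candidate. *)
Lemma fp_unit_universal (F H : presheaf C) : sheaf H ->
  forall theta : nattrans F H,
  exists! theta' :
      nattrans (fixed_point_presheaf E (initial_gset E x0_initial F)) H,
    forall x (m : F x), theta' x (fp_unit F x m) = theta x m.
Proof.
move=> shH theta; set FF := fixed_point_presheaf E _.
have theta_fixed x (n : FF x) k : k \in ext_subgroup E x ->
    gset_act (initial_gset E x0_initial H) (theta x0 (sval n)) k
      = theta x0 (sval n).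
  move=> kK; rewrite /= /initial_act -ntnat; congr (theta x0 _).
  exact: (svalP n).
have theta_ex x n := sheaf_fixed_descent shH (theta_fixed x n).
pose map x (n : FF x) : H x := sval (cid (theta_ex x n)).
have mapK x n : pmap H (iota x) (map x n) = theta x0 (sval n).
  by have [] := svalP (cid (theta_ex x n)).
have map_uniq x n t : pmap H (iota x) t = theta x0 (sval n) -> t = map x n.
  by move=> tP; have [_ /(_ _ tP)] := svalP (cid (theta_ex x n)).
have map_nat x y (f : C x y) (n : FF y) :
    map x (pmap FF f n) = pmap H f (map y n).
  (* Uniqueness in descent reduces naturality to comparing restrictions along [iota x]. *)
  apply/esym/map_uniq; have [u <-] := ext_surj E f.
  rewrite -pmapM rho_comp_iota pmapM mapK -ntnat; congr (theta x0 _).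
  rewrite [RHS](fixed_point_pmapE (M := initial_gset _ _ _)) /=.
  by rewrite /initial_act invgK.
exists (NatTrans map_nat); split=> [x m|phi phiP] /=.
  by apply/esym/map_uniq; rewrite -ntnat.
(* Equality of the components suffices, since naturality proofs are irrelevant. *)
have phiE : map = ntmap phi.
  apply: functional_extensionality_dep => x.
  apply: functional_extensionality_dep => n.
  by apply/esym/map_uniq; rewrite -ntnat pmap_iota_fp_unit phiP.
case: phi phiE {phiP} => phi phi_nat /= phiE; case: phi / phiE phi_nat => phi_nat.
by rewrite (Prop_irrelevance map_nat phi_nat).
Qed.

Lemma fixed_point_sheafification (F : presheaf C) :
  is_sheafification (atomic (extension_ore E x0_initial)) F
    (fixed_point_presheaf E (initial_gset E x0_initial F)).
Proof.
split; first exact: fixed_point_sheaf.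
by exists (fp_unit F) => H shH theta; apply: fp_unit_universal.
Qed.

(** Descent for [F] says precisely that the unit is bijective at each object; its inverse is then
    natural because the unit is. *)
Lemma sheaf_iso_fixed_point (F : presheaf C) : sheaf F ->
  presheaf_iso F (fixed_point_presheaf E (initial_gset E x0_initial F)).
Proof.
move=> shF; set FF := fixed_point_presheaf E _.
have descent x (n : FF x) := sheaf_fixed_descent shF (svalP n).
pose inv x (n : FF x) : F x := sval (cid (descent x n)).
have invK x n : fp_unit F x (inv x n) = n.
  by apply: fixed_points_inj; have [] := svalP (cid (descent x n)).
have unitK x m : inv x (fp_unit F x m) = m.
  by have [_] := svalP (cid (descent x (fp_unit F x m))); apply.
have inv_nat x y (f : C x y) (n : FF y) :
    inv x (pmap FF f n) = pmap F f (inv y n).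
  by rewrite -{1}[n]invK -ntnat unitK.
by exists (fp_unit F), (NatTrans inv_nat).
Qed.

Lemma sheaf_fixed_pointP (F : presheaf C) :
  sheaf F <-> exists M : gSet gT, presheaf_iso F (fixed_point_presheaf E M).
Proof.
split=> [shF|[M isoM]].
  by exists (initial_gset E x0_initial F); apply: sheaf_iso_fixed_point.
exact: is_sheaf_iso isoM (@fixed_point_sheaf M).
Qed.

End FixedPointSheaves.

(** * The extension with trivial kernel, and constant sheaves *)

Section TrivialExtension.
Variables (gT : finGroupType) (P : gPoset gT).

(** Arrows are equality proofs; equality on [P] is decidable, so these are unique and the category
    laws are immediate. *)
Definition discrete_category : category P :=
  @Category P (fun x y => x = y) (fun x => erefl)
    (fun _ _ _ f g => etrans g f) (fun _ _ _ => eq_irrelevance _ _)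
    (fun _ _ _ => eq_irrelevance _ _) (fun _ _ _ _ _ _ _ => eq_irrelevance _ _).

Definition discrete_to_tp_map (x y : P) (e : discrete_category x y) :
    transporter P x y :=
  let: erefl := e in tp_id x.

Lemma val_discrete_to_tp (x y : P) (e : discrete_category x y) :
  val (discrete_to_tp_map e) = 1.
Proof. by case: y / e. Qed.

Lemma discrete_to_tp_mapM (x y z : P) (f : discrete_category y z)
    (g : discrete_category x y) :
  discrete_to_tp_map (f \oc g) = discrete_to_tp_map f \oc discrete_to_tp_map g.
Proof. by apply: val_inj; rewrite /= !val_discrete_to_tp mulg1. Qed.

Definition discrete_to_tp : functor id discrete_category (transporter P) :=
  @Functor P P id discrete_category (transporter P) discrete_to_tp_map
    (fun _ => erefl) discrete_to_tp_mapM.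

Definition identity_functor : functor id (transporter P) (transporter P) :=
  @Functor P P id (transporter P) (transporter P) (fun _ _ u => u)
    (fun _ => erefl) (fun _ _ _ _ _ => erefl).

Definition trivial_extension : extension discrete_category (transporter P).
Proof.
exists discrete_to_tp identity_functor => //=.
- by move=> x y e e' _; apply: eq_irrelevance.
- by move=> x y u; exists u.
- by move=> x e; rewrite (eq_irrelevance e erefl).
move=> x y u _ <-; exists erefl; split=> [|e _]; last exact: eq_irrelevance.
by rewrite tp_comp1m.
Defined.

Lemma trivial_extension_subgroup (x : P) k :
  k \in ext_subgroup trivial_extension x -> k = 1.
Proof. by case/ext_subgroupP=> w <-; apply: val_discrete_to_tp. Qed.

(** All groups K(x) are trivial, so every element of [M] is fixed, and both presheaves act by the
    inverse label. *)
Lemma fixed_point_iso_kappa (M : gSet gT) :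
  presheaf_iso (fixed_point_presheaf trivial_extension M) (kappa P M).
Proof.
set FM := fixed_point_presheaf _ M.
have fixed (x : P) (m : M) k :
    k \in ext_subgroup trivial_extension x -> gset_act M m k = m.
  by move=> /trivial_extension_subgroup->; rewrite taction1.
pose incl x (n : FM x) : kappa P M x := sval n.
pose inv x (m : kappa P M x) : FM x := exist _ m (@fixed x m).
have incl_nat x y (u : transporter P x y) n :
    incl x (pmap FM u n) = pmap (kappa P M) u (incl y n).
  (* The functor [rho] of [trivial_extension] computes to the identity, so [u] is its own lift. *)
  exact: (@fp_map_rho _ _ _ _ trivial_extension M x y u n).
have inv_nat x y (u : transporter P x y) m :
    inv x (pmap (kappa P M) u m) = pmap FM u (inv y m).
  by apply: fixed_points_inj; rewrite -[RHS]/(incl x _) incl_nat.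
exists (NatTrans incl_nat), (NatTrans inv_nat); split=> // x n.
exact: fixed_points_inj.
Qed.

End TrivialExtension.

Theorem proposition3p5 (gT : finGroupType) (P : gPoset gT) (x0 : P)
    (x0_initial : forall x : P, (x0 <= x)%O) :
  (forall (K C : category P) (E : extension K C),
     (forall F : presheaf C,
        is_sheafification (atomic (extension_ore E x0_initial)) F
          (fixed_point_presheaf E (initial_gset E x0_initial F))) /\
     (forall F : presheaf C,
        is_sheaf (atomic (extension_ore E x0_initial)) F <->
        exists M : gSet gT, presheaf_iso F (fixed_point_presheaf E M))) /\
  (forall F : presheaf (transporter P),
     is_sheaf (atomic (transporter_ore x0_initial)) F <->
     exists M : gSet gT, presheaf_iso F (kappa P M)).
Proof.
split=> [K C E|F].
  by split=> F; [apply: fixed_point_sheafification | apply: sheaf_fixed_pointP].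
(* [is_sheaf (atomic oreC) F] does not depend on the proof [oreC]. *)
apply: (iff_trans (sheaf_fixed_pointP x0_initial (trivial_extension P) F)).
split=> -[M isoM]; exists M; apply: presheaf_iso_trans isoM _.
  exact: fixed_point_iso_kappa.
exact/presheaf_iso_sym/fixed_point_iso_kappa.
Qed.
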